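(* Let $I:(0,1)\to(0,1)$ be an increasing bijection satisfying $I(2t)\approx I(t)$ for $t\in(0,\frac12)$, and let $X$ be an r.i. space. Define $\|f\|_Z:=\|S_If\|_X$ for measurable $f$ on $(0,1)$. Then $\|\cdot\|_Z$ is an r.i.q. norm, and, denoting by $Z$ the corresponding r.i.q. space, $S_I$ is bounded on $Z$. If moreover $\int_0^t\frac{ds}{I(s)}\lesssim\frac{t}{I(t)}$ for $t\in(0,1)$, then $\|\cdot\|_Z$ is equivalent to an r.i. norm, so $Z$ is an r.i. space.
   Context: $f^*$: nonincreasing rearrangement on $(0,1)$; $S_If(t)=\frac1{I(t)}\sup_{0<s\le t}I(s)f^*(s)$. An r.i. norm $\rho$ on nonnegative measurable functions on $(0,1)$ is a norm with $\rho(f)=0$ iff $f=0$ a.e., the lattice property, the Fatou property ($f_n\nearrow f$ a.e. $\Rightarrow\rho(f_n)\nearrow\rho(f)$), $\rho(\chi_{(0,1)})<\infty$, $\int_0^1f\lesssim\rho(f)$ and $\rho(f)=\rho(f^* )$; an r.i. space is the space of $f$ with $\rho(|f|)<\infty$. An r.i.q. norm satisfies the same except the last-but-one, with the triangle inequality replaced by $\rho(f+g)\le C(\rho(f)+\rho(g))$ for some $C\ge1$. $S_I$ bounded on $Z$ means $\|S_If\|_Z\lesssim\|f\|_Z$. *)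

(* Defs.v *)
From HB Require Import structures.
From mathcomp Require Import all_boot all_order all_algebra.
From mathcomp Require Import all_classical all_reals all_analysis measurable_realfun.
Set Implicit Arguments. Unset Strict Implicit. Unset Printing Implicit Defensive.
Import Order.TTheory GRing.Theory Num.Theory.
Import numFieldNormedType.Exports.
Local Open Scope classical_set_scope.
Local Open Scope ring_scope.

Section RIDefs.
Variable R : realType.

Definition I01 : set R := `]0%R, 1%R[.

Definition nnmeas (f : R -> \bar R) : Prop :=
  measurable_fun I01 f /\ (forall x, I01 x -> (0 <= f x)%E).

Definition distrib (f : R -> \bar R) (l : R) : \bar R :=
  (@lebesgue_measure R) (I01 `&` [set x | (l%:E < `|f x|)%E]).

Definition rearr (f : R -> \bar R) (t : R) : \bar R :=
  ereal_inf [set l%:E | l in [set l : R | 0 <= l /\ (distrib f l <= t%:E)%E]].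

Definition SI (I : R -> R) (f : R -> \bar R) (t : R) : \bar R :=
  (((I t)^-1)%:E * ereal_sup [set ((I s)%:E * rearr f s)%E | s in `]0%R, t]])%E.

Definition ri_common (rho : (R -> \bar R) -> \bar R) : Prop :=
  [/\ (forall f, nnmeas f -> (0 <= rho f)%E),
      (forall f, nnmeas f ->
         (rho f = 0%E <-> {ae (@lebesgue_measure R), forall x, I01 x -> f x = 0%E})),
      (forall (a : R) f, 0 <= a -> nnmeas f ->
         rho (fun x => (a%:E * f x)%E) = (a%:E * rho f)%E),
      (forall f g, nnmeas f -> nnmeas g ->
         {ae (@lebesgue_measure R), forall x, I01 x -> (f x <= g x)%E} ->
         (rho f <= rho g)%E)
    &
      (forall (fs : nat -> R -> \bar R) f, (forall n, nnmeas (fs n)) -> nnmeas f ->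
         {ae (@lebesgue_measure R), forall x, I01 x ->
            nondecreasing_seq (fun n => fs n x) /\ (fs n x @[n --> \oo] --> f x)} ->
         rho (fs n) @[n --> \oo] --> rho f) /\
      (rho (fun x => (\1_I01 x)%:E) < +oo)%E /\
      (forall f, nnmeas f -> rho f = rho (rearr f))].

Definition is_rinorm (rho : (R -> \bar R) -> \bar R) : Prop :=
  [/\ ri_common rho,
      (forall f g, nnmeas f -> nnmeas g -> (rho (f \+ g) <= rho f + rho g)%E)
    & (exists C : R, 0 < C /\ forall f, nnmeas f ->
         (\int[@lebesgue_measure R]_(x in I01) f x <= C%:E * rho f)%E)].

Definition is_riqnorm (rho : (R -> \bar R) -> \bar R) : Prop :=
  ri_common rho /\
  (exists C : R, 1 <= C /\ forall f g, nnmeas f -> nnmeas g ->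
      (rho (f \+ g) <= C%:E * (rho f + rho g))%E).

End RIDefs.

(* Main.v *)
(** With (T h)(t) = (1 / I t) sup_{0 < s <= t} I s h(s), one has S_I f = T f^*,
    and T is monotone, homogeneous, idempotent and maps nonincreasing functions
    to nonincreasing ones, so that (S_I f)^* <= S_I f and S_I (S_I f) <= S_I f.
    The quasi-triangle inequality follows from (f + g)^*(s) <= f^*(s/2) + g^*(s/2)
    and I(s) <= c I(s/2).  For the last claim the equivalent norm is
    f |-> rho_X (T (f^** )), where f^**(t) = (1/t) int_0^t f^* is subadditive in f:
    estimating f^*(r) <= (I t / I r) (S_I f)(t) for r < t under the integral gives
    f^* <= f^** <= C S_I f, hence S_I f <= T f^** <= C S_I f. *)
Require Import Defs.
From HB Require Import structures.
From mathcomp Require Import all_boot all_order all_algebra.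
From mathcomp Require Import all_classical all_reals all_analysis measurable_realfun.
From mathcomp Require Import ring.
Import Order.TTheory GRing.Theory Num.Theory.
Import numFieldNormedType.Exports.
Local Open Scope classical_set_scope.
Local Open Scope ring_scope.

(** * Distribution functions and nonincreasing rearrangements on (0,1) *)

Section Rearrangement.
Set Implicit Arguments.
Unset Strict Implicit.
Variable R : realType.
Local Notation mu := (@lebesgue_measure R).
Local Notation I01 := (@I01 R).
Local Open Scope ereal_scope.
Implicit Types (f g h : R -> \bar R) (l m t : R).

(** If [y] is real, take [l = y]; if it is [+oo], nothing is to be shown. Comparisons of
    rearrangements thus reduce to real levels, where [rearr_leE] turns them into statements about
    [distrib]. *)
Lemma lee_real_bound (x y : \bar R) : 0 <= y ->
  (forall l, (0 <= l)%R -> y <= l%:E -> x <= l%:E) -> x <= y.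
Proof.
by case: y => [r r0 H|_ _|//]; [exact: H | exact: leey].
Qed.

Lemma I01E x : I01 x = (0 < x < 1)%R.
Proof. by rewrite /Defs.I01 /= in_itv. Qed.

Lemma I01_gt0 x : I01 x -> (0 < x)%R.
Proof. by rewrite I01E => /andP[]. Qed.

Lemma I01_lt1 x : I01 x -> (x < 1)%R.
Proof. by rewrite I01E => /andP[]. Qed.

Lemma I01_le s t : (0 < s)%R -> (s <= t)%R -> I01 t -> I01 s.
Proof. by move=> s0 st; rewrite !I01E s0 => /andP[_]; exact: le_lt_trans. Qed.

Lemma measurable_I01 : measurable I01.
Proof. exact: measurable_itv. Qed.
Local Hint Resolve measurable_I01 : core.

(** The superlevel sets of a monotone function are intervals, and the rays []x, +oo]] generate the
    Borel sets. *)
Lemma nonincreasing_emeasurable h :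
  (forall s t, I01 s -> I01 t -> (s <= t)%R -> h t <= h s) ->
  measurable_fun I01 h.
Proof.
move=> hni _; apply: (measurability _ (ErealGenOInfty.measurableE R)) => //.
move=> /= _ [_ [x ->] <-]; apply: is_interval_measurable => s t /=.
rewrite !in_itv/= !andbT => -[sI hs] [tI ht] u /andP[su ut].
have uI : I01 u by apply: I01_le ut tI; exact: lt_le_trans (I01_gt0 sI) su.
by split => //; rewrite in_itv/= andbT (lt_le_trans ht)// hni.
Qed.

Lemma nondecreasing_emeasurable h :
  (forall s t, I01 s -> I01 t -> (s <= t)%R -> h s <= h t) ->
  measurable_fun I01 h.
Proof.
move=> hnd _; apply: (measurability _ (ErealGenOInfty.measurableE R)) => //.
move=> /= _ [_ [x ->] <-]; apply: is_interval_measurable => s t /=.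
rewrite !in_itv/= !andbT => -[sI hs] [tI ht] u /andP[su ut].
have uI : I01 u by apply: I01_le ut tI; exact: lt_le_trans (I01_gt0 sI) su.
by split => //; rewrite in_itv/= andbT (lt_le_trans hs)// hnd.
Qed.

Lemma measurable_superlevel f l : nnmeas f ->
  measurable (I01 `&` [set x | l%:E < `|f x|]).
Proof.
move=> [mf _]; apply: emeasurable_fun_o_infty => //.
exact: measurableT_comp.
Qed.

Lemma nnmeas_abs f x : nnmeas f -> I01 x -> `|f x| = f x.
Proof. by move=> [_ f0] xI; rewrite gee0_abs// f0. Qed.

Lemma le_mu (A B : set R) : measurable A -> measurable B -> A `<=` B ->
  mu A <= mu B.
Proof. by move=> mA mB AB; rewrite le_measure ?inE. Qed.

Lemma mu_setU_null (A B N : set R) : measurable A -> measurable B ->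
  measurable N -> mu N = 0 -> A `<=` B `|` N -> mu A <= mu B.
Proof.
move=> mA mB mN N0 AB.
have mBN : measurable (B `|` N) by exact: measurableU.
rewrite (@le_trans _ _ (mu (B `|` N)))//; first by rewrite le_measure ?inE.
have := @measureU2 _ _ _ mu B N mB mN.
by rewrite [X in _ + X]N0 adde0.
Qed.

Lemma ae_imp (P Q : R -> Prop) : (forall x, P x -> Q x) ->
  {ae mu, forall x, P x} -> {ae mu, forall x, Q x}.
Proof.
move=> PQ; apply: negligibleS => x /= nQ Px; exact/nQ/PQ.
Qed.

Lemma distrib_le_ae f g l m : nnmeas f -> nnmeas g ->
  {ae mu, forall x, I01 x -> l%:E < f x -> m%:E < g x} ->
  distrib f l <= distrib g m.
Proof.
move=> nf ng [N [mN N0 sN]].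
apply: (mu_setU_null _ _ mN N0); [exact: measurable_superlevel..|].
move=> x [xI /=]; rewrite nnmeas_abs// => lf.
have [xN|xN] := pselect (N x); [by right|left; split => //=].
rewrite nnmeas_abs//; apply: contrapT => mg; apply/xN/sN => /=.
by move/(_ xI lf).
Qed.

(** Continuity of the measure from below: the superlevel sets of [fs n] at [ls n] increase and
    exhaust that of [f] at [l], up to a null set. With [fs] constant and levels decreasing to [l] it
    gives right-continuity of [distrib f]; with [ls] constant it gives the Fatou property of
    [rearr]. *)
Lemma distrib_le_seq (fs : nat -> R -> \bar R) (ls : nat -> R) f l (y : \bar R) :
  (forall n, nnmeas (fs n)) -> nnmeas f ->
  {ae mu, forall x, I01 x ->
     (forall n k, (n <= k)%N -> (ls n)%:E < fs n x -> (ls k)%:E < fs k x) /\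
     (l%:E < f x -> exists n, (ls n)%:E < fs n x)} ->
  (forall n, distrib (fs n) (ls n) <= y) -> distrib f l <= y.
Proof.
move=> nfs nf [N [mN N0 sN]] dy.
(* Removing the exceptional set [N] makes the sets nested everywhere, not just almost everywhere. *)
pose E n := (I01 `&` [set x | (ls n)%:E < `|fs n x|]) `\` N.
have mE n : measurable (E n) by apply: measurableD => //; exact: measurable_superlevel.
have nd : nondecreasing_seq E.
  move=> n k nk; apply/subsetPset => x [[xI /= lx] xN]; split => //; split => //=.
  move: lx; rewrite !nnmeas_abs// => lx; apply: contrapT => lk.
  by apply/xN/sN => /= /(_ xI)[/(_ n k nk lx)].
have mU : measurable (\bigcup_n E n) by exact: bigcup_measurable.
apply: (@le_trans _ _ (mu (\bigcup_n E n))).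
  apply: (mu_setU_null _ mU mN N0); first exact: measurable_superlevel.
  move=> x [xI /=]; rewrite nnmeas_abs// => lf.
  have [xN|xN] := pselect (N x); [by right|left].
  have [n ln] : exists n, (ls n)%:E < fs n x.
    by apply: contrapT => H; apply/xN/sN => /= /(_ xI)[_ /(_ lf)].
  by exists n => //; split => //; split => //=; rewrite nnmeas_abs.
have cE : mu (E n) @[n --> \oo] --> mu (\bigcup_n E n).
  exact: nondecreasing_cvg_mu.
rewrite -(cvg_lim _ cE)//; apply: lime_le; first by apply/cvg_ex; eexists; exact: cE.
apply: nearW => n /=; apply: le_trans _ (dy n).
apply: le_mu; [exact: mE|exact: measurable_superlevel|exact: subDsetl].
Qed.

Lemma distrib_le f l m : nnmeas f -> (l <= m)%R -> distrib f m <= distrib f l.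
Proof.
move=> nf lm; apply: distrib_le_ae => //; apply: aeW => x _.
by apply: le_lt_trans; rewrite lee_fin.
Qed.

Lemma distrib_le1 f l : nnmeas f -> distrib f l <= 1.
Proof.
move=> nf; rewrite (@le_trans _ _ (mu I01))//.
  by apply: le_measure; rewrite ?inE//; exact: measurable_superlevel.
by rewrite lebesgue_measure_itv/= lte_fin ltr01 oppr0 adde0.
Qed.

Lemma rearr_ge0 f t : 0 <= rearr f t.
Proof. by apply/ereal_infP => _ [l [l0 _] <-]; rewrite lee_fin. Qed.

Lemma rearr_nonincreasing f s t : (s <= t)%R -> rearr f t <= rearr f s.
Proof.
move=> st; apply: ereal_inf_le_tmp => _ [l [l0 ls] <-]; exists l => //.
by split => //; apply: le_trans ls _; rewrite lee_fin.
Qed.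

Lemma nnmeas_rearr f : nnmeas (rearr f).
Proof.
split => [|x _]; last exact: rearr_ge0.
by apply: nonincreasing_emeasurable => s t _ _; exact: rearr_nonincreasing.
Qed.
Local Hint Resolve nnmeas_rearr : core.

(* The infimum defining the rearrangement is attained, because the
   distribution function is right-continuous. *)
Lemma rearr_leE f l t : nnmeas f -> (0 <= l)%R ->
  (rearr f t <= l%:E) = (distrib f l <= t%:E).
Proof.
move=> nf l0; apply/idP/idP => [ft|ft]; last first.
  by apply: ereal_inf_lbound; exists l.
apply: (@distrib_le_seq (fun=> f) (fun n => l + n.+1%:R^-1)%R) => // [|n].
  apply: aeW => x _; split => [n k nk|lf].
    apply: le_lt_trans; rewrite lee_fin lerD2l lef_pV2 ?posrE//.
    by rewrite ler_nat.
  case: (f x) lf => [r|_|//]; last by exists 0%N; rewrite ltry.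
  rewrite lte_fin => lr.
  have [n nr] := ltr_add_invr lr; exists n.
  by rewrite lte_fin.
have /ereal_inf_ltP [_ [m [m0 mt] <-]] : rearr f t < (l + n.+1%:R^-1)%:E.
  by apply: le_lt_trans ft _; rewrite lte_fin ltrDl invr_gt0.
by rewrite lte_fin => /ltW ml; apply: le_trans mt; exact: distrib_le.
Qed.

Lemma rearr_le_distrib f g s t : nnmeas f -> nnmeas g ->
  (forall l, (0 <= l)%R -> distrib g l <= s%:E -> distrib f l <= t%:E) ->
  rearr f t <= rearr g s.
Proof.
move=> nf ng H; apply: lee_real_bound => [|l l0]; first exact: rearr_ge0.
by rewrite !rearr_leE//; exact: H.
Qed.

Lemma rearr_le_ae f g t : nnmeas f -> nnmeas g ->
  {ae mu, forall x, I01 x -> f x <= g x} -> rearr f t <= rearr g t.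
Proof.
move=> nf ng fg; apply: rearr_le_distrib => // l l0; apply: le_trans.
apply: distrib_le_ae => //; apply: ae_imp fg => x fg xI lf.
exact: lt_le_trans lf (fg xI).
Qed.

Lemma rearr_sup (fs : nat -> R -> \bar R) f t (y : \bar R) :
  (forall n, nnmeas (fs n)) -> nnmeas f ->
  {ae mu, forall x, I01 x ->
     nondecreasing_seq (fun n => fs n x) /\ (fs n x @[n --> \oo] --> f x)} ->
  (forall n, rearr (fs n) t <= y) -> rearr f t <= y.
Proof.
move=> nfs nf fsf ty; apply: lee_real_bound => [|l l0 yl].
  exact: le_trans (rearr_ge0 _ _) (ty 0%N).
rewrite rearr_leE//; apply: (@distrib_le_seq fs (fun=> l)) => // [|n].
  apply: ae_imp fsf => x fsf xI; have [nd cf] := fsf xI; split => [n k nk|lf].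
    by move=> /lt_le_trans; apply; exact: nd.
  have := ereal_nondecreasing_cvgn nd => /(cvg_unique _ cf) fE.
  move: lf; rewrite fE//= => /ereal_sup_gtP[_ [n _ <-]] ln.
  by exists n.
by rewrite -rearr_leE// (le_trans (ty n)).
Qed.

(** If [h t <= l], monotonicity confines [{h > l}] to []0, t[], which has measure [t]. Applied to
    [h = SI I f], this gives [(S_I f)^* <= S_I f]. *)
Lemma rearr_le_nonincreasing h t :
  nnmeas h -> (forall s t, I01 s -> I01 t -> (s <= t)%R -> h t <= h s) ->
  I01 t -> rearr h t <= h t.
Proof.
move=> nh hni tI; apply: lee_real_bound => [|l l0 hl]; first by apply nh.
rewrite rearr_leE// (@le_trans _ _ (mu `]0%R, t[))//.
  apply: le_measure; rewrite ?inE; [exact: measurable_superlevel|by []|].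
  move=> x [xI /=]; rewrite nnmeas_abs// => lx; rewrite in_itv/= I01_gt0//=.
  by rewrite ltNge; apply/negP => tx; move: lx; rewrite ltNge (le_trans _ hl)// hni.
by rewrite lebesgue_measure_itv/= lte_fin I01_gt0// oppr0 adde0.
Qed.

(** By [rearr_leE], [rearr f x > l] exactly when [x < distrib f l], so the superlevel set is an
    interval starting at 0 whose length is [distrib f l]. *)
Lemma distrib_rearr f l : nnmeas f -> (0 <= l)%R ->
  distrib (rearr f) l = distrib f l.
Proof.
move=> nf l0; have d1 := distrib_le1 l nf.
have d0 : 0 <= distrib f l by exact: measure_ge0.
have fd : distrib f l \is a fin_num.
  by rewrite ge0_fin_numE// (le_lt_trans d1)// ltry.
have [r fr] : exists r, distrib f l = r%:E by exists (fine (distrib f l)); rewrite fineK.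
rewrite {1}/distrib (_ : _ `&` _ = `]0%R, r[%classic); last first.
  rewrite fr in d1; apply/seteqP; split => x /=; rewrite in_itv/=.
    move=> [xI]; rewrite gee0_abs ?rearr_ge0// ltNge rearr_leE// -ltNge fr lte_fin.
    by rewrite I01_gt0.
  move=> /andP[x0 xr]; split.
    by rewrite I01E x0 (lt_le_trans xr).
  by rewrite gee0_abs ?rearr_ge0// ltNge rearr_leE// -ltNge fr lte_fin.
rewrite lebesgue_measure_itv/= lte_fin fr; case: ltP => [|r0].
  by rewrite oppr0 adde0.
by apply/eqP; rewrite eq_le -fr d0 fr lee_fin.
Qed.

Lemma rearr_rearr f : nnmeas f -> rearr (rearr f) = rearr f.
Proof.
move=> nf; apply/funext => t; rewrite {1}/rearr [RHS]/rearr; congr ereal_inf.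
by apply/seteqP; split => _ [l [l0 lt] <-]; exists l => //; move: lt;
  rewrite /= distrib_rearr.
Qed.

Lemma nnmeas_cst (c : \bar R) : 0 <= c -> nnmeas (fun=> c).
Proof. by split. Qed.

Lemma rearr_bounded f (a t : R) : (0 <= a)%R -> (0 <= t)%R ->
  (forall x, I01 x -> `|f x| <= a%:E) -> rearr f t <= a%:E.
Proof.
move=> a0 t0 fa; apply: ereal_inf_lbound; exists a => //; split => //.
rewrite /distrib (_ : _ `&` _ = set0) ?measure0 ?lee_fin//.
by apply/seteqP; split => // x [xI /=]; rewrite ltNge fa.
Qed.

Lemma nnmeasZ (a : R) f : (0 <= a)%R -> nnmeas f -> nnmeas (fun x => a%:E * f x).
Proof.
move=> a0 [mf f0]; split; first exact: measurable_funeM.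
by move=> x xI; rewrite mule_ge0 ?f0.
Qed.

Lemma nnmeasD f g : nnmeas f -> nnmeas g -> nnmeas (f \+ g).
Proof.
move=> [mf f0] [mg g0]; split; first exact: emeasurable_funD.
by move=> x xI; rewrite adde_ge0 ?f0 ?g0.
Qed.

Lemma rearrZ (a : R) f t : (0 <= a)%R -> nnmeas f -> (0 <= t)%R ->
  rearr (fun x => a%:E * f x) t = a%:E * rearr f t.
Proof.
rewrite le_eqVlt => /predU1P[<-|a0] nf t0.
  rewrite mul0e; apply/eqP; rewrite eq_le rearr_ge0 andbT rearr_bounded// => x _.
  by rewrite mul0e abse0.
have naf := nnmeasZ (ltW a0) nf.
have daf l : distrib (fun x => a%:E * f x) (a * l) = distrib f l.
  rewrite /distrib; congr (mu (_ `&` _)); apply/seteqP.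
  have a0E : 0 <= a%:E by rewrite lee_fin ltW.
  by split=> x /=; rewrite abseM (gee0_abs a0E) EFinM lte_pmul2l.
apply/eqP; rewrite eq_le; apply/andP; split.
  rewrite -lee_pdivrMl//; apply: lee_real_bound => [|l l0]; first exact: rearr_ge0.
  rewrite lee_pdivrMl// -EFinM !rearr_leE// ?daf//.
  by rewrite mulr_ge0// ltW.
apply: lee_real_bound => [|l l0]; first exact: rearr_ge0.
have al0 : (0 <= a^-1 * l)%R by rewrite mulr_ge0// invr_ge0 ltW.
have lE : l = (a * (a^-1 * l))%R by rewrite mulVKf// gt_eqF.
by rewrite -lee_pdivlMl// -EFinM !rearr_leE// {1}lE daf.
Qed.

(** With [a = f^*(s)] and [b = g^*(t)] finite, [{f + g > a + b}] lies in [{f > a}] union [{g > b}],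
    of measure at most [s + t] because both infima are attained. *)
Lemma rearrD f g s t : nnmeas f -> nnmeas g ->
  rearr (f \+ g) (s + t) <= rearr f s + rearr g t.
Proof.
move=> nf ng; have nfg := nnmeasD nf ng.
case fs: (rearr f s) (rearr_ge0 f s) => [a| |//] a0; last first.
  by rewrite addye ?leey// -ltNye (lt_le_trans _ (rearr_ge0 g t)).
case gt: (rearr g t) (rearr_ge0 g t) => [b| |//] b0; last first.
  by rewrite addey ?leey.
rewrite -EFinD rearr_leE ?addr_ge0//.
have dfa : distrib f a <= s%:E by rewrite -rearr_leE// fs.
have dgb : distrib g b <= t%:E by rewrite -rearr_leE// gt.
rewrite EFinD; apply: le_trans (leeD dfa dgb).
have mf := measurable_superlevel a nf; have mg := measurable_superlevel b ng.
apply: le_trans (@measureU2 _ _ _ mu _ _ mf mg).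
apply: (@le_measure _ _ _ mu); rewrite ?inE//; first exact: measurable_superlevel.
  exact: measurableU.
move=> x [xI /=]; rewrite nnmeas_abs//= => abfg.
have [fa|fa] := leP (f x) a%:E; [right|left]; split => //=; rewrite nnmeas_abs//.
by rewrite ltNge; apply/negP => gb; move: abfg; rewrite (nnmeas_abs nfg xI) ltNge EFinD leeD.
Qed.

(** Layer-cake formula, by Tonelli on the region below the graph of [f]. *)
Lemma ge0_integral_distrib f : nnmeas f ->
  \int[mu]_(x in I01) f x = \int[mu]_(l in `[0%R, +oo[) distrib f l.
Proof.
move=> nf; pose F := f \_ I01.
have FI x : I01 x -> F x = f x by move=> xI; rewrite /F patchE mem_set.
have FN x : ~ I01 x -> F x = 0 by move=> xI; rewrite /F patchE memNset.
have F0 x : 0 <= F x by rewrite /F patchE; case: ifPn => // /set_mem; apply nf.2.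
have mF : measurable_fun setT F by apply/(measurable_restrictT _ _).1 => //; exact: nf.1.
(* The vertical section of [A] at [x] has length [F x]. The horizontal section at [l] is the
   superlevel set of [f] when [l >= 0] and empty when [l < 0]; extending by 0 keeps points outside
   [I01] from contributing. *)
pose A := [set p : R * R | (0 <= p.2)%R /\ p.2%:E < F p.1].
have mA : measurable A.
  have mp2 : measurable_fun setT (fun p : R * R => p.2%:E) by exact: measurableT_comp.
  apply: measurableI; last first.
    rewrite -[X in measurable X]setTI; apply: measurable_lte => //.
    exact: measurableT_comp.
  rewrite (_ : (fun p => _) = setT `*` `[0%R, +oo[%classic); first exact: measurableX.
  by apply/seteqP; split => p /=; rewrite in_itv/= andbT => // -[].
have := @indic_fubini_tonelli _ _ _ _ _ mu mu A mA.
rewrite indic_fubini_tonelli_FE; last exact: mA.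
rewrite indic_fubini_tonelli_GE; last exact: mA.
move=> FG.
transitivity (\int[mu]_x (mu \o xsection A) x).
  rewrite integral_mkcond; clear FG mA mF; apply: eq_integral => x _ /=.
  rewrite -/F (_ : xsection A x = [set l | (0 <= l)%R /\ l%:E < F x]); last first.
    by apply/seteqP; split => l; rewrite /xsection/= inE.
  case FE : (F x) (F0 x) => [r| |//] r0.
    rewrite (_ : [set _ | _] = `[0%R, r[%classic); last first.
      by apply/seteqP; split => l /=; rewrite in_itv/= lte_fin => /andP.
    rewrite lebesgue_measure_itv/= lte_fin; case: ltP => [|rle].
      by rewrite oppr0 adde0.
    by apply/eqP; rewrite eq_le r0 lee_fin rle.
  rewrite (_ : [set _ | _] = `[0%R, +oo[%classic); last first.
    by apply/seteqP; split => l /=; rewrite in_itv/= andbT ltry; [case|].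
  by rewrite lebesgue_measure_itv/= ltry oppr0 adde0.
rewrite FG [RHS]integral_mkcond; clear FG mA mF; apply: eq_integral => l _ /=.
rewrite patchE; have [l0|l0] := leP 0%R l.
  rewrite mem_set/= ?in_itv/= ?andbT//.
  congr (mu _); apply/seteqP; split => x /=.
    rewrite /ysection/= => /set_mem[_ /=]; have [xI|xI] := pselect (I01 x).
      by rewrite FI// nnmeas_abs.
    by rewrite FN// lte_fin ltNge l0.
  by move=> [xI]; rewrite nnmeas_abs// /ysection/= => lf; apply/mem_set; rewrite /A/= FI.
rewrite memNset/=; last by rewrite in_itv/= andbT; apply/negP; rewrite -ltNge.
rewrite (_ : ysection A l = set0) ?measure0//.
by apply/seteqP; split => // x; rewrite /ysection/= inE => -[]/=; rewrite leNgt l0.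
Qed.

End Rearrangement.

(** * The maximal function [f^**] and its subadditivity *)

Section MaximalFunction.
Set Implicit Arguments.
Unset Strict Implicit.
Variable R : realType.
Local Notation mu := (@lebesgue_measure R).
Local Notation I01 := (@I01 R).
Local Open Scope ereal_scope.
Implicit Types (f g h : R -> \bar R) (l m t : R).
Local Hint Resolve measurable_I01 nnmeas_rearr rearr_ge0 : core.

Definition ereal_excess f l (x : R) : \bar R := maxe (f x - l%:E) 0.

Lemma nnmeas_excess f l : nnmeas f -> nnmeas (ereal_excess f l).
Proof.
move=> [mf f0]; split; last by move=> x _; rewrite le_max lexx orbT.
by apply: measurable_maxe => //; apply: emeasurable_funB.
Qed.
Local Hint Resolve nnmeas_excess : core.

Lemma excess_gt f l m x : (0 <= m)%R ->
  (m%:E < ereal_excess f l x) = ((l + m)%:E < f x).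
Proof.
move=> m0; rewrite /ereal_excess lt_max [X in _ || X]lte_fin [X in _ || X]ltNge m0 orbF.
by rewrite lteBrDr// EFinD addeC.
Qed.

Lemma distrib_excess f l m : nnmeas f -> (0 <= m)%R ->
  distrib (ereal_excess f l) m = distrib f (l + m).
Proof.
move=> nf m0; rewrite /distrib; congr (mu _); apply/seteqP.
by split => x [xI /=]; rewrite !(nnmeas_abs, excess_gt)//; auto.
Qed.

(** Cutting at height [l] shifts the distribution function by [l], so equimeasurable functions have
    excesses with equal layer-cake integrals. *)
Lemma integral_excess_rearr f l : nnmeas f -> (0 <= l)%R ->
  \int[mu]_(x in I01) ereal_excess f l x =
  \int[mu]_(x in I01) ereal_excess (rearr f) l x.
Proof.
move=> nf l0; rewrite (ge0_integral_distrib (nnmeas_excess l nf)).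
rewrite (ge0_integral_distrib (nnmeas_excess l (nnmeas_rearr f))).
apply: eq_integral => m; rewrite inE/= in_itv/= andbT => m0.
by rewrite !distrib_excess// distrib_rearr// addr_ge0.
Qed.

Lemma subset_itv_I01 t : I01 t -> `]0%R, t[ `<=` I01.
Proof.
move=> tI x /=; rewrite in_itv/= => /andP[x0 xt].
exact: I01_le x0 (ltW xt) tI.
Qed.

Lemma nnmeas_itv f t : I01 t -> nnmeas f ->
  measurable_fun `]0%R, t[ f /\ (forall x, `]0%R, t[%classic x -> 0 <= f x).
Proof.
move=> tI [mf f0]; split; last by move=> x /(subset_itv_I01 tI); exact: f0.
by apply: (@measurable_funS _ _ _ _ I01) mf; [exact: measurable_I01|exact: subset_itv_I01].
Qed.

Lemma integral_itv_cst (c : \bar R) t : I01 t ->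
  \int[mu]_(x in `]0%R, t[) c = c * t%:E.
Proof.
move=> tI; transitivity (c * mu `]0%R, t[); first exact: integral_cst.
by rewrite lebesgue_measure_itv/= lte_fin I01_gt0// oppr0 adde0.
Qed.

Lemma le_integral_itv f g t : I01 t -> nnmeas f -> nnmeas g ->
  (forall x, I01 x -> (x < t)%R -> f x <= g x) ->
  \int[mu]_(x in `]0%R, t[) f x <= \int[mu]_(x in `]0%R, t[) g x.
Proof.
move=> tI nf ng fg; have [mf f0] := nnmeas_itv tI nf; have [mg g0] := nnmeas_itv tI ng.
apply: ge0_le_integral => // x xt; apply: fg; first exact: subset_itv_I01 xt.
by move: xt => /=; rewrite in_itv => /andP[].
Qed.

Lemma integral_itvD f (c : R) t : I01 t -> (0 <= c)%R -> nnmeas f ->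
  \int[mu]_(x in `]0%R, t[) (c%:E + f x) =
  c%:E * t%:E + \int[mu]_(x in `]0%R, t[) f x.
Proof.
move=> tI c0 nf; have [mf f0] := nnmeas_itv tI nf.
by rewrite ge0_integralD// integral_itv_cst.
Qed.

(** Integrate [f^* <= l + (f^* - l)_+] over []0, t[], then enlarge the domain of the excess to
    [I01]. *)
Lemma integral_rearr_le f l t : nnmeas f -> I01 t -> (0 <= l)%R ->
  \int[mu]_(x in `]0%R, t[) rearr f x <=
  l%:E * t%:E + \int[mu]_(x in I01) ereal_excess f l x.
Proof.
move=> nf tI l0; rewrite integral_excess_rearr//.
have ne := nnmeas_excess l (nnmeas_rearr f).
apply: (@le_trans _ _ (\int[mu]_(x in `]0%R, t[) (l%:E + ereal_excess (rearr f) l x))).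
  apply: le_integral_itv => //; first exact: (nnmeasD (nnmeas_cst _) ne).
  move=> x _ _; rewrite /ereal_excess -leeBlDl// le_max lexx//.
rewrite integral_itvD// leeD2l//; apply: ge0_subset_integral.
- exact: measurable_itv.
- exact: measurable_I01.
- exact: ne.1.
- exact: ne.2.
- exact: subset_itv_I01.
Qed.

(** At the level [l = f^*(t)] nothing is lost: the excess of [f^*] vanishes from [t] on, and before
    [t] one has [f^* >= l], so [l + (f^* - l)_+ = f^*]. *)
Lemma integral_rearr_ge f l t : nnmeas f -> I01 t -> (0 <= l)%R ->
  rearr f t = l%:E ->
  l%:E * t%:E + \int[mu]_(x in I01) ereal_excess f l x <=
  \int[mu]_(x in `]0%R, t[) rearr f x.
Proof.
move=> nf tI l0 ft; rewrite integral_excess_rearr//.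
have ne := nnmeas_excess l (nnmeas_rearr f).
have -> : \int[mu]_(x in I01) ereal_excess (rearr f) l x =
          \int[mu]_(x in `]0%R, t[) ereal_excess (rearr f) l x.
  rewrite integral_mkcond [RHS]integral_mkcond; apply: eq_integral => x _.
  rewrite !patchE; case: ifPn => [/set_mem xI|xI]; last first.
    rewrite memNset// => /(subset_itv_I01 tI) /mem_set xI'.
    by rewrite xI' in xI.
  case: ifPn => // /negP xt; apply/eqP; rewrite eq_le (nnmeas_excess l _).2// andbT.
  rewrite /ereal_excess ge_max lexx andbT leeBlDr// add0e -ft.
  apply: rearr_nonincreasing; rewrite leNgt; apply/negP => xt'; apply: xt.
  by rewrite inE/= in_itv/= xt' I01_gt0.
rewrite -integral_itvD//; apply: le_integral_itv => //.
  exact: (nnmeasD (nnmeas_cst _) ne).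
move=> x xI xt; have : l%:E <= rearr f x.
  by rewrite -ft; exact/rearr_nonincreasing/ltW.
rewrite /ereal_excess; case: (rearr f x) => [r| |//]; rewrite ?leey// lee_fin => lr.
by rewrite -EFinB max_l ?lee_fin ?subr_ge0// addrC subrK.
Qed.

Lemma integral_rearr_pinfty f t : I01 t -> rearr f t = +oo ->
  \int[mu]_(x in `]0%R, t[) rearr f x = +oo.
Proof.
move=> tI ft; apply/eqP; rewrite -leye_eq.
apply: (@le_trans _ _ (\int[mu]_(x in `]0%R, t[) (cst +oo x))).
  by rewrite integral_itv_cst// gt0_mulye// lte_fin I01_gt0.
apply: le_integral_itv => //; first exact: nnmeas_cst.
move=> x _ xt; rewrite /= -ft; exact/rearr_nonincreasing/ltW.
Qed.

(* int_0^t f^* is the infimum over l >= 0 of l t + int (f - l)_+, attained at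
   l = f^*(t); the quantity under the infimum is subadditive in (f, l). *)
Lemma integral_rearrD f g t : nnmeas f -> nnmeas g -> I01 t ->
  \int[mu]_(x in `]0%R, t[) rearr (f \+ g) x <=
  \int[mu]_(x in `]0%R, t[) rearr f x + \int[mu]_(x in `]0%R, t[) rearr g x.
Proof.
move=> nf ng tI; have nfg := nnmeasD nf ng.
have i0 h : 0 <= \int[mu]_(x in `]0%R, t[) rearr h x by apply: integral_ge0.
have noo h : \int[mu]_(x in `]0%R, t[) rearr h x != -oo by rewrite -ltNye (lt_le_trans _ (i0 h)).
case fl: (rearr f t) (rearr_ge0 f t) => [l| |//] l0; last first.
  by rewrite (integral_rearr_pinfty tI fl) addye ?leey.
case gm: (rearr g t) (rearr_ge0 g t) => [m| |//] m0; last first.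
  by rewrite (integral_rearr_pinfty tI gm) addey ?leey.
rewrite lee_fin in l0; rewrite lee_fin in m0.
apply: le_trans (leeD (integral_rearr_ge nf tI l0 fl) (integral_rearr_ge ng tI m0 gm)).
apply: le_trans (integral_rearr_le nfg tI (addr_ge0 l0 m0)) _.
have nef := nnmeas_excess l nf; have neg := nnmeas_excess m ng.
rewrite addeACA -muleDl// -EFinD leeD2l//.
have [mf f0] := nef; have [mg g0] := neg.
rewrite -ge0_integralD//; last exact: measurable_I01.
have [mfg fg0] := nnmeas_excess (l + m) nfg.
apply: ge0_le_integral; [exact: measurable_I01|exact: fg0|exact: mfg|..].
  exact: (nnmeasD nef neg).1.
move=> x xI; rewrite /ereal_excess ge_max adde_ge0 ?f0 ?g0// andbT.
rewrite EFinD leeBlDr//=.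
(* Since [l] and [m] are real, they can be subtracted and added back even where [f] or [g] is
   infinite. *)
apply: (@le_trans _ _ ((f x - l%:E + l%:E) + (g x - m%:E + m%:E))).
  by rewrite !subeK.
rewrite addeACA; apply: leeD => //.
by apply: leeD; rewrite le_max lexx.
Qed.

Definition maxfun f t : \bar R := (t^-1)%:E * \int[mu]_(x in `]0%R, t[) rearr f x.

Lemma rearr_le_maxfun f t : I01 t -> rearr f t <= maxfun f t.
Proof.
move=> tI; rewrite /maxfun lee_pdivlMl ?I01_gt0//.
have [ft|ft] := eqVneq (rearr f t) +oo.
  by rewrite integral_rearr_pinfty// leey.
case fl: (rearr f t) ft (rearr_ge0 f t) => [l| |] // _; rewrite lee_fin => l0.
rewrite muleC -integral_itv_cst//; apply: le_integral_itv => //.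
by move=> x _ xt; rewrite -fl; exact/rearr_nonincreasing/ltW.
Qed.

Lemma maxfun_le f g t : I01 t ->
  (forall s, I01 s -> rearr f s <= rearr g s) -> maxfun f t <= maxfun g t.
Proof.
move=> tI fg; have t0 := I01_gt0 tI.
rewrite /maxfun lee_pmul2l; [|by []|by rewrite lte_fin invr_gt0].
by apply: le_integral_itv => // x xI _; exact: fg.
Qed.

Lemma maxfunZ (a : R) f t : (0 <= a)%R -> nnmeas f -> I01 t ->
  maxfun (fun x => a%:E * f x) t = a%:E * maxfun f t.
Proof.
move=> a0 nf tI; rewrite /maxfun muleCA; congr (_ * _).
have [mf f0] := nnmeas_itv tI (nnmeas_rearr f).
rewrite -ge0_integralZl_EFin//; apply: eq_integral => x /set_mem/(subset_itv_I01 tI) xI.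
by rewrite rearrZ// ltW// I01_gt0.
Qed.

Lemma maxfun_bounded f (c t : R) : (0 <= c)%R -> I01 t ->
  (forall x, I01 x -> `|f x| <= c%:E) -> maxfun f t <= c%:E.
Proof.
move=> c0 tI fc; rewrite /maxfun lee_pdivrMl ?I01_gt0//.
rewrite muleC -integral_itv_cst//; apply: le_integral_itv => //.
by move=> x xI _; apply: rearr_bounded => //; exact/ltW/I01_gt0.
Qed.

Lemma maxfunD f g t : nnmeas f -> nnmeas g -> I01 t ->
  maxfun (f \+ g) t <= maxfun f t + maxfun g t.
Proof.
move=> nf ng tI; rewrite /maxfun -ge0_muleDr ?integral_ge0//.
by rewrite lee_wpmul2l ?integral_rearrD// lee_fin invr_ge0 ltW ?I01_gt0.
Qed.

(** Replaces convergence by order conditions, the form in which the Fatou property passes through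
    rearrangement and suprema. *)
Lemma nondecreasing_cvgn_lub (u : nat -> \bar R) (y : \bar R) :
  nondecreasing_seq u -> (forall n, u n <= y) ->
  (forall z, (forall n, u n <= z) -> y <= z) -> u n @[n --> \oo] --> y.
Proof.
move=> nd uy ylub; suff -> : y = ereal_sup (range u) by exact: ereal_nondecreasing_cvgn.
apply/eqP; rewrite eq_le; apply/andP; split.
  by apply: ylub => n; apply: ereal_sup_ubound; exists n.
by apply/ereal_supP => _ [n _ <-].
Qed.

(** * Monotone limits of rearrangements and maximal functions *)

Section Fatou.
Variables (fs : nat -> R -> \bar R) (f : R -> \bar R).
Hypotheses (nfs : forall n, nnmeas (fs n)) (nf : nnmeas f).
Hypothesis fsf : {ae mu, forall x, I01 x ->
  nondecreasing_seq (fun n => fs n x) /\ (fs n x @[n --> \oo] --> f x)}.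

Lemma ae_nondecreasing n k : (n <= k)%N ->
  {ae mu, forall x, I01 x -> fs n x <= fs k x}.
Proof. by move=> nk; apply: ae_imp fsf => x /[apply] -[nd _]; exact: nd. Qed.

Lemma ae_le_limit n : {ae mu, forall x, I01 x -> fs n x <= f x}.
Proof.
apply: ae_imp fsf => x /[apply] -[nd cf].
rewrite (cvg_unique _ cf (ereal_nondecreasing_cvgn nd))//.
by apply: ereal_sup_ubound; exists n.
Qed.

Lemma rearr_cvg t : rearr (fs n) t @[n --> \oo] --> rearr f t.
Proof.
apply: nondecreasing_cvgn_lub => [n k nk|n|y].
- exact: rearr_le_ae (ae_nondecreasing nk).
- exact: rearr_le_ae (ae_le_limit n).
- exact: rearr_sup.
Qed.

(** Monotone convergence under the integral, applied to the nondecreasing sequence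
    [rearr (fs n)]. *)
Lemma maxfun_sup t (y : \bar R) : I01 t ->
  (forall n, maxfun (fs n) t <= y) -> maxfun f t <= y.
Proof.
move=> tI fy; have t0 := I01_gt0 tI; rewrite /maxfun (lee_pdivrMl _ _ t0).
have fy' n : \int[mu]_(x in `]0%R, t[) rearr (fs n) x <= t%:E * y.
  by rewrite -(lee_pdivrMl _ _ t0); exact: fy.
have m n := (nnmeas_itv tI (nnmeas_rearr (fs n))).1.
have nd x : nondecreasing_seq (fun n => rearr (fs n) x).
  by move=> n k nk; exact: rearr_le_ae (ae_nondecreasing nk).
have -> : \int[mu]_(x in `]0%R, t[) rearr f x =
    \int[mu]_(x in `]0%R, t[) (limn (fun n => rearr (fs n) x)).
  by apply: eq_integral => x _; rewrite (cvg_lim _ (@rearr_cvg x)).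
rewrite monotone_convergence//; apply: lime_le; last exact: nearW.
apply: ereal_nondecreasing_is_cvgn => n k nk.
by apply: le_integral_itv => // x _ _; exact: nd.
Qed.

End Fatou.

End MaximalFunction.

(** * The weighted supremum operator *)

Section SupremumOperator.
Set Implicit Arguments.
Unset Strict Implicit.
Variables (R : realType) (I : R -> R).
Local Notation mu := (@lebesgue_measure R).
Local Notation I01 := (@I01 R).
Local Open Scope ereal_scope.
Implicit Types (f g h : R -> \bar R) (s t : R).
Hypothesis Iinc : {in I01 &, {homo I : x y / (x < y)%R}}.
Hypothesis Imap : forall x, I01 x -> I01 (I x).

(* [SI I f] is [supop (rearr f)]. *)
Definition supop h t : \bar R :=
  ((I t)^-1)%:E * ereal_sup [set (I s)%:E * h s | s in `]0%R, t]].

Lemma weight_gt0 t : I01 t -> (0 < I t)%R.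
Proof. by move=> /Imap /I01_gt0. Qed.

Lemma weight_le s t : I01 s -> I01 t -> (s <= t)%R -> (I s <= I t)%R.
Proof.
move=> sI tI; rewrite le_eqVlt => /predU1P[->//|st].
by apply/ltW/Iinc; rewrite ?inE.
Qed.

Lemma supopE h t : I01 t ->
  (I t)%:E * supop h t = ereal_sup [set (I s)%:E * h s | s in `]0%R, t]].
Proof.
by move=> tI; rewrite muleA -EFinM mulfV ?mul1e// gt_eqF// weight_gt0.
Qed.

(** Multiplying by [I t > 0] cancels the prefactor, so a bound on [supop] becomes a family of
    pointwise inequalities; most later estimates start from this form. *)
Lemma supopP h t (y : \bar R) : I01 t ->
  supop h t <= y <->
  forall s, I01 s -> (s <= t)%R -> (I s)%:E * h s <= (I t)%:E * y.
Proof.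
move=> tI; rewrite -(@lee_pmul2l _ (I t)%:E) ?lte_fin ?weight_gt0//.
rewrite supopE//; split => [/ereal_supP hy s sI st|hy].
  by apply: hy; exists s => //=; rewrite in_itv/= I01_gt0.
apply/ereal_supP => _ [s /= sit <-]; move: sit; rewrite in_itv/= => /andP[s0 st].
by apply: hy => //; exact: I01_le tI.
Qed.

Lemma le_supop s t h : I01 t -> I01 s -> (s <= t)%R ->
  (I s)%:E * h s <= (I t)%:E * supop h t.
Proof. by move=> tI; have /(supopP h _ tI) := lexx (supop h t); exact. Qed.

Lemma le_supop_diag h t : I01 t -> h t <= supop h t.
Proof.
move=> tI; rewrite -(@lee_pmul2l _ (I t)%:E) ?lte_fin ?weight_gt0//.
exact: le_supop.
Qed.

Lemma supop_mono h g t : I01 t -> (forall s, I01 s -> h s <= g s) ->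
  supop h t <= supop g t.
Proof.
move=> tI hg; apply/supopP => // s sI st; apply: le_trans (le_supop g tI sI st).
by rewrite lee_pmul2l ?lte_fin ?weight_gt0// hg.
Qed.

Section Nonneg.
Variable h : R -> \bar R.
Hypothesis h0 : forall s, I01 s -> 0 <= h s.

Lemma supop_ge0 t : I01 t -> 0 <= supop h t.
Proof. by move=> tI; exact: le_trans (h0 tI) (le_supop_diag _ tI). Qed.

Lemma nnmeas_weightV : nnmeas (fun t => ((I t)^-1)%:E).
Proof.
split; last by move=> t tI; rewrite lee_fin invr_ge0 ltW ?weight_gt0.
apply: nonincreasing_emeasurable => s t sI tI st.
by rewrite lee_fin lef_pV2 ?posrE ?weight_gt0// weight_le.
Qed.

(** Both factors are monotone in [t]: [1 / I] decreases and the supremum over []0, t]] increases. *)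
Lemma nnmeas_supop : nnmeas (supop h).
Proof.
split; last exact: supop_ge0.
apply: emeasurable_funM; first exact: nnmeas_weightV.1.
apply: nondecreasing_emeasurable => s t sI tI st.
apply: ereal_sup_le => _ [r /= rs <-]; exists r => //; move: rs.
by rewrite /= !in_itv/= => /andP[-> /le_trans]; exact.
Qed.

(** The weight cancels: [I s * supop h s] is the supremum over []0, s]], which only grows when [s]
    is replaced by [t]. *)
Lemma supop_supop t : I01 t -> supop (supop h) t <= supop h t.
Proof.
move=> tI; apply/supopP => // s sI st; rewrite !supopE//.
apply: ereal_sup_le => _ [r /= rs <-]; exists r => //; move: rs.
by rewrite /= !in_itv/= => /andP[-> /le_trans]; exact.
Qed.

Lemma supop_nonincreasing :
  (forall s t, I01 s -> I01 t -> (s <= t)%R -> h t <= h s) ->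
  forall s t, I01 s -> I01 t -> (s <= t)%R -> supop h t <= supop h s.
Proof.
move=> hni s t sI tI st; apply/supopP => // r rI rt.
(* For [r <= s] the term already occurs in the supremum at [s], and [I s <= I t]. For [r > s], use
   [h r <= h s <= supop h s] and [I r <= I t]. *)
have [rs|/ltW sr] := leP r s.
  apply: le_trans (le_supop h sI rI rs) _.
  by apply: lee_wpmul2r; [exact: supop_ge0|rewrite lee_fin weight_le].
apply: lee_pmul; [by rewrite lee_fin ltW ?weight_gt0|exact: h0|by rewrite lee_fin weight_le|].
exact: le_trans (hni _ _ sI rI sr) (le_supop_diag _ sI).
Qed.

Lemma supopZ g (a : R) t : (0 <= a)%R -> I01 t ->
  (forall s, I01 s -> g s = a%:E * h s) -> supop g t = a%:E * supop h t.
Proof.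
move=> a0 tI gE; apply/eqP; rewrite eq_le; apply/andP; split.
  apply/supopP => // s sI st; rewrite gE// muleCA [X in _ <= X]muleCA.
  by apply: lee_wpmul2l; [rewrite lee_fin|exact: le_supop].
have [a00|an0] := eqVneq a 0%R.
  by rewrite a00 mul0e (le_trans _ (le_supop_diag _ tI))// gE// a00 mul0e.
have {an0}a0 : (0 < a)%R by rewrite lt_def an0.
rewrite -lee_pdivlMl//; apply/supopP => // s sI st.
rewrite muleCA lee_pdivlMl// muleCA -gE//; exact: le_supop.
Qed.

Lemma supop_bounded (c : R) t : I01 t ->
  (forall s, I01 s -> h s <= c%:E) -> supop h t <= c%:E.
Proof.
move=> tI hc; apply/supopP => // s sI st.
apply: lee_pmul; [by rewrite lee_fin ltW ?weight_gt0|exact: h0|by rewrite lee_fin weight_le|].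
exact: hc.
Qed.

(** The suprema over [s] and over [n] may be interchanged; this carries the Fatou property through
    [supop]. *)
Lemma supop_lub (hs : nat -> R -> \bar R) t (y : \bar R) : I01 t ->
  (forall s z, I01 s -> (forall n, hs n s <= z) -> h s <= z) ->
  (forall n, supop (hs n) t <= y) -> supop h t <= y.
Proof.
move=> tI hsup hy; apply/supopP => // s sI st; rewrite -lee_pdivlMl ?weight_gt0//.
apply: hsup => // n; rewrite lee_pdivlMl ?weight_gt0//.
by have /(supopP _ _ tI) := hy n; exact.
Qed.

End Nonneg.

Lemma supopD h f g t : I01 t ->
  (forall s, I01 s -> 0 <= f s) -> (forall s, I01 s -> 0 <= g s) ->
  (forall s, I01 s -> h s <= f s + g s) ->
  supop h t <= supop f t + supop g t.
Proof.
move=> tI f0 g0 hfg; apply/supopP => // s sI st.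
have Is := weight_gt0 sI.
apply: (@le_trans _ _ ((I s)%:E * (f s + g s))).
  by rewrite lee_pmul2l ?lte_fin// hfg.
rewrite ge0_muleDr ?f0 ?g0// ge0_muleDr ?(supop_ge0 f0) ?(supop_ge0 g0)//.
by apply: leeD; exact: le_supop.
Qed.

(** Doubling at [s / 2 < 1 / 2] gives [I s <= c * I (s / 2)], and [s / 2] is itself an admissible
    point of the suprema defining [supop f t] and [supop g t]. *)
Lemma supop_dilation h f g (c : R) t : I01 t -> (0 < c)%R ->
  (forall s, (0 < s < 1 / 2)%R -> (I (2 * s) <= c * I s)%R) ->
  (forall s, I01 s -> 0 <= f s) -> (forall s, I01 s -> 0 <= g s) ->
  (forall s, I01 s -> h s <= f (s / 2)%R + g (s / 2)%R) ->
  supop h t <= c%:E * (supop f t + supop g t).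
Proof.
move=> tI c0 Ic f0 g0 hfg; apply/supopP => // s sI st.
have Is := weight_gt0 sI; have s0 := I01_gt0 sI; have s1 := I01_lt1 sI.
have s20 : (0 < s / 2)%R by rewrite divr_gt0.
have s2s : (s / 2 <= s)%R by rewrite ler_pdivrMr// ler_peMr ?ltW// ltr1n.
have s2I := I01_le s20 s2s sI; have s2t := le_trans s2s st.
have Is2 := weight_gt0 s2I.
apply: (@le_trans _ _ ((I s)%:E * (f (s / 2)%R + g (s / 2)%R))).
  by rewrite lee_pmul2l ?lte_fin// hfg.
apply: (@le_trans _ _ ((c * I (s / 2))%:E * (f (s / 2)%R + g (s / 2)%R))).
  apply: lee_wpmul2r; first by rewrite adde_ge0 ?f0 ?g0.
  rewrite lee_fin; have := Ic (s / 2)%R; rewrite mulrCA divff// mulr1; apply.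
  by rewrite s20 ltr_pM2r.
rewrite EFinM -muleA muleCA [X in _ <= X]muleCA.
rewrite ?[(I _)%:E * (c%:E * _)]muleCA.
apply: lee_wpmul2l; first by rewrite lee_fin ltW.
rewrite ge0_muleDr ?f0 ?g0// ge0_muleDr ?(supop_ge0 f0) ?(supop_ge0 g0)//.
by apply: leeD; exact: le_supop.
Qed.

(** * Function norms of the form [rho (supop (D f))] *)

Section FunctionNorm.
Variables (rho : (R -> \bar R) -> \bar R) (D : (R -> \bar R) -> R -> \bar R).
Hypothesis rhoP : ri_common rho.
Hypothesis D_ge : forall f t, I01 t -> rearr f t <= D f t.
Hypothesis D_le : forall f g t, I01 t ->
  (forall s, I01 s -> rearr f s <= rearr g s) -> D f t <= D g t.
Hypothesis DZ : forall (a : R) f t, (0 <= a)%R -> nnmeas f -> I01 t ->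
  D (fun x => a%:E * f x) t = a%:E * D f t.
Hypothesis D_bounded : forall f (c : R) t, (0 <= c)%R -> I01 t ->
  (forall x, I01 x -> `|f x| <= c%:E) -> D f t <= c%:E.
Hypothesis D_sup : forall (fs : nat -> R -> \bar R) f,
  (forall n, nnmeas (fs n)) -> nnmeas f ->
  {ae mu, forall x, I01 x ->
     nondecreasing_seq (fun n => fs n x) /\ (fs n x @[n --> \oo] --> f x)} ->
  forall t (y : \bar R), I01 t -> (forall n, D (fs n) t <= y) -> D f t <= y.

Lemma rho_le f g : nnmeas f -> nnmeas g ->
  (forall x, I01 x -> f x <= g x) -> rho f <= rho g.
Proof.
by case: rhoP => _ _ _ rle _ nf ng fg; apply: rle => //; exact: aeW.
Qed.

Lemma rho_eq f g : nnmeas f -> nnmeas g ->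
  (forall x, I01 x -> f x = g x) -> rho f = rho g.
Proof.
move=> nf ng fg; apply/eqP; rewrite eq_le.
by rewrite !rho_le// => x xI; rewrite fg.
Qed.

Let D_ge0 f t : I01 t -> 0 <= D f t.
Proof. by move=> tI; exact: le_trans (rearr_ge0 _ _) (D_ge _ tI). Qed.

Let nnD f : nnmeas (supop (D f)).
Proof. by apply: nnmeas_supop => s; exact: D_ge0. Qed.

(** Rearrangement invariance gives [rho f = rho (rearr f)], and [rearr f <= D f <= supop (D f)].
    This yields definiteness and later the embedding into [L^1]. *)
Lemma rho_le_supop f : nnmeas f -> rho f <= rho (supop (D f)).
Proof.
move=> nf; have [_ _ _ _ [_ [_ ->]]] := rhoP => //.
apply: rho_le => // [|x xI]; first exact: nnmeas_rearr.
exact: le_trans (D_ge _ xI) (le_supop_diag _ xI).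
Qed.

(** Keeping [D] abstract serves two norms at once: [D = rearr] gives [rhoZ], and [D = maxfun] gives
    the equivalent norm. *)
Lemma ri_common_supop : ri_common (fun f => rho (supop (D f))).
Proof.
have [r0 rz rZ rle [rF [r1 rr]]] := rhoP.
have Dae f g t : nnmeas f -> nnmeas g ->
    {ae mu, forall x, I01 x -> f x <= g x} -> I01 t ->
    supop (D f) t <= supop (D g) t.
  move=> nf ng fg tI; apply: supop_mono => // s sI; apply: D_le => // r rI.
  exact: rearr_le_ae.
have nn0 : nnmeas (fun _ : R => 0 : \bar R) by exact: nnmeas_cst.
split.
- by move=> f _; exact: r0.
- move=> f nf; split => [f0|f0].
    apply/(rz _ nf)/eqP; rewrite eq_le r0// andbT -f0; exact: rho_le_supop.
  apply/(rz _ (nnD f)); apply: aeW => t tI.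
  apply/eqP; rewrite eq_le (nnD f).2// andbT.
  (* As [f] vanishes almost everywhere, [D f] is dominated by [D 0], which [D_bounded] with constant
     0 makes nonpositive. *)
  apply: (@le_trans _ _ (supop (D (fun=> 0)) t)).
    by apply: Dae => //; apply: ae_imp f0 => x /[apply] ->.
  apply: supop_bounded => // [s|s sI]; first exact: D_ge0.
  by apply: D_bounded => // x _; rewrite abse0.
- move=> a f a0 nf; rewrite -rZ//; apply: rho_eq => //; first exact: nnmeasZ.
  by move=> t tI; apply: supopZ => // s; exact: DZ.
- by move=> f g nf ng fg; apply: rho_le => // t; exact: Dae.
- split; last split.
  (* Almost everywhere convergence of [fs] becomes monotone convergence of [supop (D (fs n))] at
     every point of [I01]. *)
  + move=> fs f nfs nf fsf; apply: rF => //; apply: aeW => t tI.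
    have nd : nondecreasing_seq (fun n => supop (D (fs n)) t).
      by move=> n k nk; apply: Dae => //; exact: (ae_nondecreasing fsf).
    split => //; apply: nondecreasing_cvgn_lub => // [n|y].
      by apply: Dae => //; exact: (ae_le_limit fsf).
    apply: supop_lub => // s z sI; exact: (D_sup nfs nf fsf).
  + apply: le_lt_trans r1; apply: rho_le => //.
      split; last by move=> x _; rewrite lee_fin.
      by apply/measurable_EFinP/measurable_indic; exact: measurable_I01.
    move=> t tI; rewrite indicE mem_set//.
    apply: supop_bounded => // [s|s sI]; first exact: D_ge0.
    by apply: D_bounded => // x xI; rewrite indicE mem_set// gee0_abs.
  (* By [D_le], [D] sees a function only through its rearrangement, and [rearr] is idempotent. *)
  + move=> f nf; apply: rho_eq => // t tI; apply/eqP; rewrite eq_le.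
    by rewrite !supop_mono// => s sI; apply: D_le => // r rI; rewrite rearr_rearr.
Qed.

End FunctionNorm.

Lemma maxfun_le_supop (C : R) f t : (0 < C)%R -> I01 t ->
  \int[mu]_(s in `]0%R, t[) ((I s)^-1)%:E <= (C * (t / I t))%:E ->
  maxfun f t <= C%:E * supop (rearr f) t.
Proof.
move=> C0 tI IC.
have It := weight_gt0 tI; have t0 := I01_gt0 tI.
have f0 s : I01 s -> 0 <= rearr f s by move=> _; exact: rearr_ge0.
have AE := le_supop (rearr f) tI.
(* If the supremum is a real [a], then [f^*(s) <= I t * a / I s] on []0, t[] and the assumed
   integral bound applies; if it is [+oo], the right-hand side is infinite. *)
have := supop_ge0 f0 tI; case SE: (supop (rearr f) t) AE => [a| |//] AE a0.
  rewrite /maxfun lee_pdivrMl//.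
  have nV : nnmeas (fun s => (I t * a)%:E * ((I s)^-1)%:E).
    by apply: nnmeasZ; [rewrite mulr_ge0// ltW|exact: nnmeas_weightV].
  apply: (@le_trans _ _ (\int[mu]_(s in `]0%R, t[) ((I t * a)%:E * ((I s)^-1)%:E))).
    apply: le_integral_itv => // [|s sI st]; first exact: nnmeas_rearr.
    rewrite lee_pdivlMr ?weight_gt0// muleC EFinM; apply: AE => //; exact: ltW.
  have [mV V0] := nnmeas_itv tI nnmeas_weightV.
  rewrite ge0_integralZl_EFin//; last by rewrite mulr_ge0// ltW.
  apply: (@le_trans _ _ ((I t * a)%:E * (C * (t / I t))%:E)).
    by apply: lee_wpmul2l => //; rewrite lee_fin mulr_ge0// ltW.
  rewrite -!EFinM lee_fin le_eqVlt; apply/orP; left; apply/eqP.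
  by field; rewrite gt_eqF.
by rewrite gt0_muley ?leey.
Qed.

End SupremumOperator.

(** * The quasi-norm, boundedness of [S_I], and the equivalent norm *)

Theorem theorem3p11 (R : realType) (I : R -> R) (rhoX : (R -> \bar R) -> \bar R) :
  {in @I01 R &, {homo I : x y / x < y}} ->
  (forall x, @I01 R x -> @I01 R (I x)) ->
  (forall y, @I01 R y -> exists2 x, @I01 R x & I x = y) ->
  (exists c1 c2 : R, 0 < c1 /\ 0 < c2 /\
     forall t, 0 < t < 1 / 2 -> c1 * I t <= I (2 * t) <= c2 * I t) ->
  is_rinorm rhoX ->
  let rhoZ := fun f : R -> \bar R => rhoX (SI I f) in
  [/\ is_riqnorm rhoZ,
      (exists C : R, 0 < C /\
         forall f, nnmeas f -> (rhoZ (SI I f) <= C%:E * rhoZ f)%E)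
    & ((exists C : R, forall t, @I01 R t ->
          (\int[@lebesgue_measure R]_(s in `]0%R, t[) ((I s)^-1)%:E
             <= (C * (t / I t))%:E)%E) ->
       exists rho' : (R -> \bar R) -> \bar R, is_rinorm rho' /\
         exists c C : R, 0 < c /\ 0 < C /\
           forall f, nnmeas f ->
             (c%:E * rho' f <= rhoZ f)%E /\ (rhoZ f <= C%:E * rho' f)%E)].
Proof.
move=> Iinc Imap _ [c1 [c2 [_ [c20 Ic]]]] [rhoP rhoD rho1] rhoZ.
have f0 (f : R -> \bar R) s : I01 s -> (0 <= rearr f s)%E by move=> _; exact: rearr_ge0.
have m0 (f : R -> \bar R) s : I01 s -> (0 <= maxfun f s)%E.
  by move=> sI; exact: le_trans (rearr_ge0 _ _) (rearr_le_maxfun _ sI).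
have nZ f : nnmeas (SI I f) := nnmeas_supop Iinc Imap (f0 f).
have nM f : nnmeas (supop I (maxfun f)) := nnmeas_supop Iinc Imap (m0 f).
have [_ _ rhoM _ [_ [_ rhor]]] := rhoP.
have rho_ge0 f : nnmeas f -> (0 <= rhoX f)%E by have [+ _ _ _ _] := rhoP; apply.
have rle := rho_le rhoP.
split.
- split.
    apply: (@ri_common_supop R I Iinc Imap rhoX (@rearr R) rhoP) => //.
    + by move=> f g t tI; apply.
    + by move=> a f t a0 nf tI; apply: rearrZ => //; exact/ltW/I01_gt0.
    + by move=> f c t c0 tI; apply: rearr_bounded => //; exact/ltW/I01_gt0.
    + by move=> fs f nfs nf fsf t y _; exact: rearr_sup fsf.
  (* [c2] is the upper doubling constant of [I]; the maximum meets the requirement that the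
     quasi-triangle constant be at least 1. *)
  exists (Num.max 1 c2); split; first by rewrite le_max lexx.
  move=> f g nf ng; have nZD := nnmeasD (nZ f) (nZ g).
  apply: (@le_trans _ _ (rhoX (fun x => c2%:E * (SI I f \+ SI I g) x)%E)).
    apply: rle => //; first exact/nnmeasZ/nZD/ltW.
    move=> t tI; apply: (@supop_dilation _ _ Imap _ (rearr f) (rearr g) c2 t tI c20).
    + by move=> s /Ic /andP[].
    + exact: f0.
    + exact: f0.
    + by move=> s sI; rewrite {1}(splitr s); exact: rearrD.
  rewrite (rhoM _ _ (ltW c20) nZD); apply: (@le_trans _ _ (c2%:E * (rhoZ f + rhoZ g))%E).
    by rewrite lee_pmul2l ?lte_fin//; exact: rhoD.
  apply: lee_wpmul2r; first by rewrite adde_ge0 ?rho_ge0.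
  by rewrite lee_fin le_max lexx orbT.
(* Constant 1 suffices pointwise: [SI I f] is nonincreasing, so it dominates its own rearrangement,
   and [supop] is idempotent. *)
- exists 1; split => // f nf; rewrite mul1e; apply: rle => [||t tI]; [exact: nZ|exact: nZ|].
  apply: le_trans (supop_supop Imap (rearr f) tI).
  apply: (supop_mono Imap) => // s sI; apply: rearr_le_nonincreasing => //.
  apply: (supop_nonincreasing Iinc Imap (f0 f)) => r u _ _; exact: rearr_nonincreasing.
- move=> [C IC]; exists (fun f => rhoX (supop I (maxfun f))); split.
    split.
    + apply: (@ri_common_supop R I Iinc Imap rhoX (@maxfun R) rhoP).
      * exact: rearr_le_maxfun.
      * exact: maxfun_le.
      * exact: maxfunZ.
      * exact: maxfun_bounded.
      * by move=> fs f nfs nf fsf t y; exact: (maxfun_sup nfs nf fsf).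
    + move=> f g nf ng; apply: le_trans (rhoD _ _ (nM f) (nM g)).
      apply: rle => //; first exact: nnmeasD.
      move=> t tI; apply: (supopD Imap) => //; [exact: m0..|].
      by move=> s sI; exact: maxfunD.
    + have [A [A0 rhoA]] := rho1; exists A; split => // f nf.
      apply: le_trans (rhoA _ nf) _; rewrite lee_pmul2l ?lte_fin//.
      apply: (rho_le_supop Iinc Imap rhoP) => //; exact: rearr_le_maxfun.
  (* The given [C] carries no sign, so it is enlarged to a positive [C']. The lower constant is then
     [C'^-1], from [f^** <= C' * S_I f], and the upper one is 1, from [f^* <= f^**]. *)
  pose C' := Num.max C 1; have C'0 : 0 < C' by rewrite lt_max ltr01 orbT.
  exists C'^-1, 1; split; first by rewrite invr_gt0.
  split => // f nf; rewrite mul1e; split.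
    rewrite lee_pdivrMl// -(rhoM _ _ (ltW C'0) (nZ f)); apply: rle => //.
      by apply: nnmeasZ => //; exact: ltW.
    move=> t tI; rewrite /SI.
    (* Bound [f^**] by [C' * S_I f] inside [supop], pull [C'] out, and absorb the second [supop] by
       idempotence. *)
    apply: (@le_trans _ _ (supop I (fun s => C'%:E * supop I (rearr f) s)%E t)).
      apply: (supop_mono Imap) => // s sI; apply: (maxfun_le_supop Iinc Imap) => //.
      apply: le_trans (IC _ sI) _; rewrite lee_fin ler_wpM2r//.
        by rewrite divr_ge0 ?ltW ?(weight_gt0 Imap)// I01_gt0.
      by rewrite le_max lexx.
    rewrite (@supopZ _ _ Imap (supop I (rearr f)) _ C' _ (ltW C'0) tI)//.
    by rewrite lee_pmul2l ?lte_fin//; exact: supop_supop.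
  by apply: rle => // t tI; apply: (supop_mono Imap) => // s sI; exact: rearr_le_maxfun.
Qed.
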